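(* Let $\mathbf U=\langle\langle U,\approx\rangle,\preceq\rangle$ be a completely lattice $\mathbf L$-ordered set and $\sim$ a complete $\mathbf L$-tolerance on $\mathbf U$. Then the pair of maps $\langle{}_\sim,{}^\sim\rangle$, $u\mapsto u_\sim$ and $u\mapsto u^\sim$, is an extensive isotone $\mathbf L$-Galois connection on $\mathbf U$.
   Context: $\mathbf L=\langle L,\wedge,\vee,\otimes,\to,0,1\rangle$ is a complete residuated lattice ($\langle L,\wedge,\vee,0,1\rangle$ complete lattice, $\langle L,\otimes,1\rangle$ commutative monoid, $a\otimes b\le c$ iff $a\le b\to c$). An $\mathbf L$-set in $X$ is a map $X\to L$; $L^X$ the set of them; $S(A,B)=\bigwedge_x(A(x)\to B(x))$. An $\mathbf L$-equality is a binary $\mathbf L$-relation that is reflexive, symmetric, transitive ($R(x,y)\otimes R(y,z)\le R(x,z)$) and with $R(x,y)=1\Rightarrow x=y$. An $\mathbf L$-ordered set is $\langle\langle U,\approx\rangle,\preceq\rangle$, $\approx$ an $\mathbf L$-equality, $\preceq$ reflexive, transitive, compatible with $\approx$ ($(u\preceq v)\otimes(u\approx u')\otimes(v\approx v')\le(u'\preceq v')$), and $(u\preceq v)\wedge(v\preceq u)\le u\approx v$; $u\le v$ means $(u\preceq v)=1$. For $V\in L^U$: $\mathcal L V(v)=\bigwedge_u(V(u)\to(v\preceq u))$, $\mathcal U V(v)=\bigwedge_u(V(u)\to(u\preceq v))$; $\inf V$ is the unique $u$ with $\mathcal L V(u)=1=\mathcal U(\mathcal L V)(u)$, $\sup V$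 the unique $u$ with $\mathcal U V(u)=1=\mathcal L(\mathcal U V)(u)$; completely lattice means these exist for all $V$. Power relation: for $R$ on $X$, $A,B\in L^X$, $(R\circ B)(x)=\bigvee_y R(x,y)\otimes B(y)$, $(A\circ R)(y)=\bigvee_x A(x)\otimes R(x,y)$, $R^+(A,B)=S(A,R\circ B)\wedge S(B,A\circ R)$. A binary $\mathbf L$-relation $R$ on $\mathbf U$ is complete if it is compatible with $\approx$ ($R(u,v)\otimes(u\approx u')\otimes(v\approx v')\le R(u',v')$) and $R^+(V_1,V_2)\le R(\inf V_1,\inf V_2)$, $R^+(V_1,V_2)\le R(\sup V_1,\sup V_2)$ for all $V_1,V_2\in L^U$. An $\mathbf L$-tolerance is a reflexive symmetric binary $\mathbf L$-relation. For $u\in U$, $[u]_\sim(v)=u\sim v$, $u_\sim=\inf[u]_\sim$, $u^\sim=\sup[u]_\sim$. An isotone $\mathbf L$-Galois connection on $\mathbf U$ is a pair $\langle f,g\rangle$ of maps $U\to U$ with $(f(u)\preceq v)=(u\preceq g(v))$ for all $u,v$; it is extensive if $f(u)\le u$ and $g(u)\ge u$ for all $u$. *)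

(* Defs.v *)
From HB Require Import structures.
Set Warnings "-notation-overridden".
From mathcomp Require Import all_boot all_order.
From mathcomp Require Import boolp classical_sets.

Set Implicit Arguments.
Unset Strict Implicit.
Unset Printing Implicit Defensive.

Import Order.TTheory.
Local Open Scope order_scope.
Local Open Scope classical_set_scope.

(* The lattice constants 0 and 1 are \bot and \top; the degenerate case
   \bot = \top is allowed.  The choiceType structure that MathComp orders carry
   costs no generality: classically every type has one. *)
HB.mixin Record TBLattice_isCompleteResiduated (d : Order.disp_t) L
    of Order.TBLattice d L := {
  tens : L -> L -> L;
  resid : L -> L -> L;
  infimums_ex : forall A : set L, infimums A !=set0;
  supremums_ex : forall A : set L, supremums A !=set0;
  tensA : associative tens;
  tensC : commutative tens;
  tens1x : left_id \top tens;
  tens_resid : forall a b c : L, (tens a b <= c) = (a <= resid b c)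
}.

#[short(type="complResLatticeType")]
HB.structure Definition CompleteResiduatedLattice (d : Order.disp_t) :=
  { L of TBLattice_isCompleteResiduated d L & Order.TBLattice d L }.

Notation "a ⊗ b" := (tens a b) (at level 40, left associativity) : order_scope.
Notation "a ⇒ b" := (resid a b) (at level 55, right associativity) : order_scope.

(* infimum and supremum return their first argument on the empty set, so these
   defaults give the empty meet and the empty join. *)
Notation "⋀ x , F" := (infimum \top (range (fun x => F)))
  (at level 200, x name, F at level 200) : order_scope.
Notation "⋁ x , F" := (supremum \bot (range (fun x => F)))
  (at level 200, x name, F at level 200) : order_scope.

Section Bounds.
Context {d : Order.disp_t} {L : complResLatticeType d}.

Lemma bigmeetP (A : set L) : infimums A (infimum \top A).
Proof.
rewrite /infimum; case: eqP => [->|_]; first by split=> // x _; exact: lex1.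
have [x Ax] := infimums_ex A; by case: xgetP => [y _|/(_ x)].
Qed.

Lemma bigjoinP (A : set L) : supremums A (supremum \bot A).
Proof.
rewrite /supremum; case: eqP => [->|_]; first by split=> // x _; exact: le0x.
have [x Ax] := supremums_ex A; by case: xgetP => [y _|/(_ x)].
Qed.

End Bounds.

Section LSets.
Context {d : Order.disp_t} {L : complResLatticeType d}.

Definition Lset (X : Type) := X -> L.
Definition Lrel (X : Type) := X -> X -> L.

Definition Lsub (X : Type) (A B : Lset X) : L := ⋀ x, (A x ⇒ B x).

Definition Lreflexive (X : Type) (R : Lrel X) := forall x, R x x = \top.
Definition Lsymmetric (X : Type) (R : Lrel X) := forall x y, R x y = R y x.
Definition Ltransitive (X : Type) (R : Lrel X) :=
  forall x y z, R x y ⊗ R y z <= R x z.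

Definition Lequality (X : Type) (R : Lrel X) :=
  [/\ Lreflexive R, Lsymmetric R, Ltransitive R
    & forall x y, R x y = \top -> x = y].

Definition Ltolerance (X : Type) (R : Lrel X) := Lreflexive R /\ Lsymmetric R.

Definition Lcompatible (X : Type) (E R : Lrel X) :=
  forall u v u' v', R u v ⊗ E u u' ⊗ E v v' <= R u' v'.

Definition comp_rel_set (X : Type) (R : Lrel X) (B : Lset X) : Lset X :=
  fun x => ⋁ y, (R x y ⊗ B y).
Definition comp_set_rel (X : Type) (A : Lset X) (R : Lrel X) : Lset X :=
  fun y => ⋁ x, (A x ⊗ R x y).

Definition power_rel (X : Type) (R : Lrel X) : Lrel (Lset X) :=
  fun A B => Order.meet (Lsub A (comp_rel_set R B)) (Lsub B (comp_set_rel A R)).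

End LSets.

Arguments Lset {d} L X.
Arguments Lrel {d} L X.

Record LorderedSet {d : Order.disp_t} (L : complResLatticeType d) := {
  Lcarrier :> Type;
  Leq : Lrel L Lcarrier;
  Lle : Lrel L Lcarrier;
  LeqP : Lequality Leq;
  Lle_refl : Lreflexive Lle;
  Lle_trans : Ltransitive Lle;
  Lle_compat : Lcompatible Leq Lle;
  Lle_antisym : forall u v, Order.meet (Lle u v) (Lle v u) <= Leq u v
}.

Section Cones.
Context {d : Order.disp_t} {L : complResLatticeType d} (U : LorderedSet L).

Definition lower_cone (V : Lset L U) : Lset L U :=
  fun v => ⋀ u, (V u ⇒ Lle v u).
Definition upper_cone (V : Lset L U) : Lset L U :=
  fun v => ⋀ u, (V u ⇒ Lle u v).

Definition is_Linf (V : Lset L U) (u : U) :=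
  lower_cone V u = \top /\ upper_cone (lower_cone V) u = \top.
Definition is_Lsup (V : Lset L U) (u : U) :=
  upper_cone V u = \top /\ lower_cone (upper_cone V) u = \top.

Lemma bigmeet_top (X : Type) (F : X -> L) x : (⋀ y, (F y)) = \top -> F x = \top.
Proof.
move=> E; apply/eqP; rewrite -le1x -[leLHS]E.
by have [+ _] := bigmeetP (range F); apply; exists x.
Qed.

Lemma resid_top (a b : L) : a ⇒ b = \top -> a = \top -> b = \top.
Proof.
move=> /[swap] -> E; apply/eqP; rewrite -le1x.
by rewrite -[leLHS](tens1x \top) tens_resid E.
Qed.

Lemma Lle_anti (u v : U) : Lle u v = \top -> Lle v u = \top -> u = v.
Proof.
move=> uv vu; have [_ _ _] := LeqP U; apply; apply/eqP; rewrite -le1x.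
by have := Lle_antisym u v; rewrite uv vu meetxx.
Qed.

Lemma is_Linf_unique (V : Lset L U) u v : is_Linf V u -> is_Linf V v -> u = v.
Proof.
move=> [lu ulu] [lv ulv].
by apply: Lle_anti; [apply: resid_top (bigmeet_top u ulv) lu
                    |apply: resid_top (bigmeet_top v ulu) lv].
Qed.

Lemma is_Lsup_unique (V : Lset L U) u v : is_Lsup V u -> is_Lsup V v -> u = v.
Proof.
move=> [lu ulu] [lv ulv].
by apply: Lle_anti; [apply: resid_top (bigmeet_top v ulu) lv
                    |apply: resid_top (bigmeet_top u ulv) lu].
Qed.

Definition isotone_Galois (f g : U -> U) :=
  forall u v, Lle (f u) v = Lle u (g v).

Definition extensive_pair (f g : U -> U) :=
  (forall u, Lle (f u) u = \top) /\ (forall u, Lle u (g u) = \top).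

End Cones.

Record completelyLattice {d : Order.disp_t} (L : complResLatticeType d) := {
  Lordered_of :> LorderedSet L;
  Linf_ex : forall V : Lset L Lordered_of, exists u, is_Linf V u;
  Lsup_ex : forall V : Lset L Lordered_of, exists u, is_Lsup V u
}.

Section CompletelyLattice.
Context {d : Order.disp_t} {L : complResLatticeType d} (U : completelyLattice L).

Definition Linf (V : Lset L U) : U := sval (cid (Linf_ex V)).
Definition Lsup (V : Lset L U) : U := sval (cid (Lsup_ex V)).

Lemma LinfP (V : Lset L U) : is_Linf V (Linf V).
Proof. exact: svalP (cid (Linf_ex V)). Qed.

Lemma LsupP (V : Lset L U) : is_Lsup V (Lsup V).
Proof. exact: svalP (cid (Lsup_ex V)). Qed.

Definition complete_Lrel (R : Lrel L U) :=
  [/\ Lcompatible (@Leq _ _ U) R,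
      forall V1 V2, power_rel R V1 V2 <= R (Linf V1) (Linf V2)
    & forall V1 V2, power_rel R V1 V2 <= R (Lsup V1) (Lsup V2)].

Definition Lclass (R : Lrel L U) (u : U) : Lset L U := fun v => R u v.
Definition lower_map (R : Lrel L U) (u : U) : U := Linf (Lclass R u).
Definition upper_map (R : Lrel L U) (u : U) : U := Lsup (Lclass R u).

End CompletelyLattice.

(* Main.v *)
(** Completeness applied to the class of [u] and the crisp singleton of [u]
    shows that [u] is fully similar to [u_~] and to [u^~].  Put
    [a = (u_~ ⪯ v)].  The L-sets [{a/u_~, 1/v}] and [{a/u, 1/v}] are related to
    degree 1, hence so are their suprema.  The first supremum is [v], so the
    second one, [w], satisfies [w ≤ v^~], while [a ≤ (u ⪯ w)]; thus
    [(u_~ ⪯ v) ≤ (u ⪯ v^~)].  The converse inequality is the order dual. *)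

Require Import Defs.
From mathcomp Require Import all_boot all_order.
From mathcomp Require Import boolp classical_sets.

Set Implicit Arguments.
Unset Strict Implicit.
Unset Printing Implicit Defensive.

Import Order.TTheory.
Local Open Scope order_scope.
Local Open Scope classical_set_scope.

Section LSetTheory.
Context {d : Order.disp_t} {L : complResLatticeType d}.
Implicit Types (X : Type) (a b : L).

Lemma le_top_eq a : \top <= a -> a = \top.
Proof. by rewrite le1x => /eqP. Qed.

Lemma resid_eq_top a b : a ⇒ b = \top <-> a <= b.
Proof.
rewrite -[X in X <= b](tens1x a) tens_resid.
by split=> [->|/le_top_eq].
Qed.

Lemma bigjoin_ge X (F : X -> L) x : F x <= ⋁ y, (F y).
Proof. by have [+ _] := bigjoinP (range F); apply; exists x. Qed.

Lemma Lsub_eq_top X (A B : Lset L X) :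
  Lsub A B = \top <-> forall x, A x <= B x.
Proof.
split=> [E x|AB]; first exact/resid_eq_top/(bigmeet_top x E).
apply: le_top_eq; have [_] := bigmeetP (range (fun x => A x ⇒ B x)).
by apply=> _ [x _ <-]; have /resid_eq_top -> := AB x.
Qed.

Lemma power_rel_eq_top X (R : Lrel L X) (A B : Lset L X) :
    (forall x, A x <= comp_rel_set R B x) ->
    (forall y, B y <= comp_set_rel A R y) ->
  power_rel R A B = \top.
Proof.
by rewrite /power_rel => /Lsub_eq_top -> /Lsub_eq_top ->; rewrite meetxx.
Qed.

Lemma le_comp_rel_set X (R : Lrel L X) (B : Lset L X) x y :
  R x y = \top -> B y <= comp_rel_set R B x.
Proof.
by move=> Rxy; have := bigjoin_ge (fun z => R x z ⊗ B z) y; rewrite Rxy tens1x.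
Qed.

Lemma le_comp_rel_set1 X (R : Lrel L X) (B : Lset L X) x y :
  B y = \top -> R x y <= comp_rel_set R B x.
Proof.
move=> By; have := bigjoin_ge (fun z => R x z ⊗ B z) y.
by rewrite By tensC tens1x.
Qed.

(** For symmetric [R], both halves of [power_rel] become bounds by the same kind of composition. *)
Lemma comp_set_relE X (R : Lrel L X) (A : Lset L X) :
  Lsymmetric R -> comp_set_rel A R = comp_rel_set R A.
Proof.
move=> Rsym; apply/funext => y; rewrite /comp_set_rel /comp_rel_set.
suff -> : (fun x => A x ⊗ R x y) = (fun x => R y x ⊗ A x) by [].
by apply/funext => x; rewrite tensC Rsym.
Qed.

(* The L-set {a/p, 1/q}; if p = q, the degree 1 prevails. *)
Definition wpair X a (p q : X) : Lset L X :=
  fun x => if `[< x = q >] then \top else if `[< x = p >] then a else \bot.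

Lemma wpair_top X a (p q : X) : wpair a p q q = \top.
Proof. by rewrite /wpair asboolT. Qed.

Lemma wpair_ge X a (p q : X) : a <= wpair a p q p.
Proof. by rewrite /wpair; case: ifP => _; [exact: lex1|rewrite asboolT]. Qed.

(** Off [p] and [q] the value is [\bot], so only these two points need a check; if [p = q], the
    condition at [q] decides. *)
Lemma wpair_le X a (p q : X) (F : Lset L X) :
  a <= F p -> F q = \top -> forall x, wpair a p q x <= F x.
Proof.
move=> aF Fq x; rewrite /wpair; case: asboolP => [->|_]; first by rewrite Fq.
by case: asboolP => [->|_] //; exact: le0x.
Qed.

(** The point [p] is matched with [p'], which carries at least the weight [a], and [q] with itself
    by reflexivity. *)
Lemma power_rel_wpair X (R : Lrel L X) a (p p' q : X) :
  Ltolerance R -> R p p' = \top ->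
  power_rel R (wpair a p q) (wpair a p' q) = \top.
Proof.
move=> [Rrefl Rsym] Rpp'.
(* Kept general in [r] and [s] so that, by symmetry of [R], it serves both halves with [p] and [p']
   exchanged. *)
have le_wpair r s : R r s = \top ->
    forall x, wpair a r q x <= comp_rel_set R (wpair a s q) x.
  move=> Rrs; apply: wpair_le.
    exact: le_trans (wpair_ge a s q) (le_comp_rel_set _ Rrs).
  by apply: le_top_eq; rewrite -[leLHS](Rrefl q) le_comp_rel_set1 ?wpair_top.
apply: power_rel_eq_top; first exact: le_wpair.
by rewrite comp_set_relE //; apply: le_wpair; rewrite Rsym.
Qed.

End LSetTheory.

Section Duality.
Context {d : Order.disp_t} {L : complResLatticeType d}.

Section DualOrder.
Variable U : LorderedSet L.

Let dual_le : Lrel L U := fun u v => Lle v u.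

Lemma dual_le_trans : Ltransitive dual_le.
Proof. by move=> u v w; rewrite tensC; exact: Lle_trans. Qed.

Lemma dual_le_compat : Lcompatible (@Leq _ _ U) dual_le.
Proof.
move=> u v u' v'; rewrite -tensA [Leq u u' ⊗ _]tensC tensA.
exact: Lle_compat.
Qed.

Lemma dual_le_antisym (u v : U) :
  Order.meet (dual_le u v) (dual_le v u) <= Leq u v.
Proof. by rewrite meetC; exact: Lle_antisym. Qed.

Definition dualLorderedSet : LorderedSet L :=
  @Build_LorderedSet _ _ U _ dual_le (LeqP U) (@Lle_refl _ _ U)
    dual_le_trans dual_le_compat dual_le_antisym.

End DualOrder.

(* Under this definition [Linf] and [Lsup] of the dual are, by conversion,
   [Lsup] and [Linf] of [U]. *)
Definition dualCompletelyLattice (U : completelyLattice L) :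
    completelyLattice L :=
  @Build_completelyLattice _ _ (dualLorderedSet U) (@Lsup_ex _ _ U)
    (@Linf_ex _ _ U).

(** Compatibility and [power_rel] do not involve [Lle], so reversing the order just swaps the
    clauses for [Linf] and [Lsup]. *)
Lemma complete_Lrel_dual (U : completelyLattice L) (R : Lrel L U) :
  complete_Lrel R -> @complete_Lrel _ _ (dualCompletelyLattice U) R.
Proof. by case=> Rcomp Rinf Rsup; split. Qed.

End Duality.

Section CompleteTolerance.
Context {d : Order.disp_t} {L : complResLatticeType d}.

Lemma Lsup_ge (U : completelyLattice L) (V : Lset L U) u :
  V u <= Lle u (Lsup V).
Proof. by have [/Lsub_eq_top] := LsupP V. Qed.

(** The bound on [a] makes [q] an upper bound; as a member to degree 1, [q] is also below every
    upper bound. *)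
Lemma Lsup_wpair (U : completelyLattice L) a (p q : U) :
  a <= Lle p q -> Lsup (wpair a p q) = q.
Proof.
move=> apq; apply: is_Lsup_unique (LsupP _) _; split.
  by apply/Lsub_eq_top; apply: wpair_le; [|exact: Lle_refl].
apply/Lsub_eq_top => w; rewrite -[leLHS]tens1x tensC tens_resid.
have [+ _] := bigmeetP (range (fun x => wpair a p q x ⇒ Lle x w)).
by apply; exists q => //; rewrite wpair_top.
Qed.

Lemma tol_upper_map (U : completelyLattice L) (R : Lrel L U) u :
  Ltolerance R -> complete_Lrel R -> R u (upper_map R u) = \top.
Proof.
move=> [Rrefl Rsym] [_ _ Rsup]; apply: le_top_eq.
(* [wpair \bot u u] is the crisp singleton of [u], whose supremum is [u]. *)
have := Rsup (wpair \bot u u) (Lclass R u).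
rewrite Lsup_wpair ?le0x // power_rel_eq_top //.
  apply: wpair_le; first exact: le0x.
  apply: le_top_eq; rewrite -[leLHS](Rrefl u).
  by apply: le_comp_rel_set1; exact: Rrefl.
move=> x; rewrite comp_set_relE // /Lclass Rsym.
by apply: le_comp_rel_set1; rewrite wpair_top.
Qed.

Lemma tol_lower_map (U : completelyLattice L) (R : Lrel L U) u :
  Ltolerance R -> complete_Lrel R -> R u (lower_map R u) = \top.
Proof.
move=> Rtol /complete_Lrel_dual.
exact: (@tol_upper_map (dualCompletelyLattice U) R u Rtol).
Qed.

Lemma le_upper_map (U : completelyLattice L) (R : Lrel L U) u v :
  Ltolerance R -> complete_Lrel R ->
  Lle (lower_map R u) v <= Lle u (upper_map R v).
Proof.
move=> Rtol Rcompl; set a := Lle _ v.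
have [_ _ /(_ (wpair a (lower_map R u) v) (wpair a u v))] := Rcompl.
rewrite Lsup_wpair // power_rel_wpair //; last first.
  by rewrite (proj2 Rtol) tol_lower_map.
set w := Lsup _ => /le_top_eq Rvw.
(* By [Rvw], [w] belongs to the class of [v] to degree 1. *)
have w_le : Lle w (upper_map R v) = \top.
  by apply: le_top_eq; rewrite -[leLHS]Rvw; exact: (Lsup_ge (Lclass R v)).
have /le_trans -> // : a <= Lle u w.
  exact: le_trans (wpair_ge a u v) (Lsup_ge _ _).
by rewrite -[leLHS]tens1x tensC -w_le; exact: Lle_trans.
Qed.

(** In the dual, [lower_map] and [upper_map] trade places and [Lle] flips, so [le_upper_map] there,
    taken at [v] and [u] in this order, is this inequality. *)
Lemma le_lower_map (U : completelyLattice L) (R : Lrel L U) u v :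
  Ltolerance R -> complete_Lrel R ->
  Lle u (upper_map R v) <= Lle (lower_map R u) v.
Proof.
move=> Rtol /complete_Lrel_dual.
exact: (@le_upper_map (dualCompletelyLattice U) R v u Rtol).
Qed.

(** Reflexivity puts [u] in its own class to degree 1. *)
Lemma upper_map_ge (U : completelyLattice L) (R : Lrel L U) u :
  Lreflexive R -> Lle u (upper_map R u) = \top.
Proof.
move=> Rrefl; apply: le_top_eq; rewrite -[leLHS](Rrefl u).
exact: (Lsup_ge (Lclass R u)).
Qed.

Lemma lower_map_le (U : completelyLattice L) (R : Lrel L U) u :
  Lreflexive R -> Lle (lower_map R u) u = \top.
Proof. exact: (@upper_map_ge (dualCompletelyLattice U) R u). Qed.

End CompleteTolerance.

Theorem theorem11 (d : Order.disp_t) (L : complResLatticeType d)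
    (U : completelyLattice L) (R : Lrel L U)
    (Rtol : Ltolerance R) (Rcompl : complete_Lrel R) :
  isotone_Galois (lower_map R) (upper_map R) /\
  extensive_pair (lower_map R) (upper_map R).
Proof.
have [Rrefl _] := Rtol.
split; last by split=> u; [exact: lower_map_le|exact: upper_map_ge].
move=> u v; apply/eqP; rewrite eq_le.
by rewrite le_upper_map ?le_lower_map.
Qed.
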